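(* Let $n,k$ be integers with $2\le k\le n-2$. The map $\psi:\mathrm{SYT}(n-k,2,1^{k-2})\to\mathrm{SYT}(n-k,2,1^{k-2})$ (defined in the context) is a bijection which generates a $\mathbb{Z}_n$-action (that is, $\psi^n$ is the identity) and which cyclically shifts the cyclic descent set: for every $T\in\mathrm{SYT}(n-k,2,1^{k-2})$, $$\mathrm{cDes}(\psi T)=-1+\mathrm{cDes}(T),$$ with addition modulo $n$.
   Context: Let $[n]=\{1,\dots,n\}$. Tableaux are in English notation (row 1 on top), $T_{i,j}$ is the entry in row $i$, column $j$, and $T^t$ is the transpose of $T$ (the transpose of the shape $(n-k,2,1^{k-2})$ is $(k,2,1^{n-k-2})$, which is of the same form with $k$ replaced by $n-k$). $\mathrm{Des}(T)=\{i\in[n-1]:i+1\text{ is in a lower row than }i\text{ in }T\}$. For $D\subseteq[n]$, $-1+D\subseteq[n]$ is obtained by subtracting $1$ modulo $n$ from each element of $D$. For $T\in\mathrm{SYT}(n-k,2,1^{k-2})$ with $2\le k\le n-2$, $\mathrm{cDes}(T)\subseteq[n]$ is defined by $\mathrm{cDes}(T)\cap[n-1]=\mathrm{Des}(T)$ and: $n\in\mathrm{cDes}(T)$ if and only if the entry $T_{2,2}-1$ is in the first column of $T$. (One has $|\mathrm{cDes}(T)|=k$ and $\mathrm{cDes}(T^t)=[n]\setminus\mathrm{cDes}(T)$.) The map $\psi$ is defined for all shapes $(n-k,2,1^{k-2})$, $2\le k\le n-2$, as follows. - If $1\notin\mathrm{cDes}(T)$: the first row of $\psi T$ contains the entries $[n]\setminus\mathrm{cDes}(T)$,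 increasing from left to right. The entry $(\psi T)_{2,2}$ equals: $T_{2,2}-1$, if $T_{2,2}-1$ is in the first row of $T$ (equivalently $n\notin\mathrm{cDes}(T)$); $a-1$, if $T_{2,2}-1$ is in the first column of $T$ and $a$ is the entry immediately below it; $n$, if $T_{2,2}-1$ is at the bottom of the first column of $T$. The remaining letters are placed in the first column of $\psi T$, increasing from top to bottom. - If $1\in\mathrm{cDes}(T)$: $\psi T:=(\psi(T^t))^t$, where $\psi(T^t)$ is given by the previous case (since $1\notin\mathrm{cDes}(T^t)$). *)

(* Defs.v *)
From mathcomp Require Import all_boot.

Set Implicit Arguments.
Unset Strict Implicit.
Unset Printing Implicit Defensive.

(* Tableaux in English notation are lists of rows, top row first.  Rows and
   columns are 0-based lists, so row 1, column 1 of the paper is index 0. *)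
Definition tableau := seq (seq nat).

(* For a partition shape, the rows of length > j are the topmost ones, so no
   cell is displaced by the filter. *)
Definition column (T : tableau) (j : nat) : seq nat :=
  [seq nth 0 r j | r <- T & j < size r].

Definition transpose (T : tableau) : tableau :=
  mkseq (column T) (size (head [::] T)).

Definition is_syt (sh : seq nat) (T : tableau) : bool :=
  [&& shape T == sh,
      perm_eq (flatten T) (iota 1 (sumn sh)),
      all (sorted ltn) T
    & all (sorted ltn) (transpose T)].

Definition SYT (sh : seq nat) := {T : tableau | is_syt sh T}.

Definition near_hook (n k : nat) : seq nat := n - k :: 2 :: nseq (k - 2) 1.

Definition row_of (T : tableau) (x : nat) : nat :=
  find (fun r : seq nat => x \in r) T.

(* Subsets of [n] = {1, ..., n} are lists of naturals, compared with =i. *)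
Definition Des (n : nat) (T : tableau) : seq nat :=
  [seq i <- iota 1 n.-1 | row_of T i < row_of T i.+1].

Definition entry22 (T : tableau) : nat := nth 0 (nth [::] T 1) 1.

Definition cDes (n : nat) (T : tableau) : seq nat :=
  Des n T ++ (if (entry22 T).-1 \in column T 0 then [:: n] else [::]).

(* -1 + D, with representatives of the residues modulo n taken in [n]. *)
Definition shift_down (n : nat) (D : seq nat) : seq nat :=
  [seq (if i == 1 then n else i.-1) | i <- D].

Definition psi22 (n : nat) (T : tableau) : nat :=
  let b := (entry22 T).-1 in
  let c := column T 0 in
  if b \in head [::] T then b
  else if b == last 0 c then n
  else (nth 0 c (index b c).+1).-1.

(* The case 1 \notin cDes T.  The corner of the first column is then the 1
   already placed in the first row, so the remaining letters fill the first
   column from the second row downwards. *)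
Definition psi_no1 (n : nat) (T : tableau) : tableau :=
  let r := [seq i <- iota 1 n | i \notin cDes n T] in
  let x := psi22 n T in
  let c := [seq i <- iota 1 n | (i \notin r) && (i != x)] in
  r :: [:: head 0 c; x] :: [seq [:: y] | y <- behead c].

Definition psi (n : nat) (T : tableau) : tableau :=
  if 1 \in cDes n T then transpose (psi_no1 n (transpose T))
  else psi_no1 n T.

(* Main.v *)
Require Import Defs.
From mathcomp Require Import all_boot zify.

(** A standard tableau of shape (n-k, 2, 1^(k-2)) is determined by a binary
    word together with one marked position.  Take the cyclic word w on
    positions 1, ..., n with w i true when the cyclic predecessor of i is a
    cyclic descent.  Reading off descents shows that, for 1 < i and
    i <> x := T_(2,2), the letter w i says whether i lies in the first column,
    while w x and w 1 record on which side x - 1 lies: w (x-1) = w 1 and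
    w x <> w 1.  So x is a position where w leaves the value w 1, and
    standardness says exactly that it is not the first such position
    ([syt_word_tabP], [word_tab_syt], [mem_cDes]).

    In these terms, everything becomes transparent.  Transposing the tableau
    negates w and keeps x ([transpose_word_tab]).  The map psi rotates w by one
    step ([psi_word_tab]), hence it shifts the cyclic descent set.  The mark is
    carried along rigidly when w 2 = w 1; when w 2 <> w 1 the value that is to
    be left becomes the opposite one, and the mark slides to the next place
    where w changes.  This rule is invariant under negation, so it covers both
    cases in the definition of psi.

    It remains to see that psi has order dividing n.  Let j be the number of
    changes of w strictly between position 1 and the mark.  If w 2 = w 1, the
    rotation moves no change out of this window; if w 2 <> w 1, the change at
    position 2 leaves the window and the sliding of the mark brings exactly one
    change, the old mark itself, into it.  So j is invariant
    ([changes_rot]).  After n steps w is back to its initial value, and (w, j)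
    determines the mark ([changes_inj]), so the tableau is back too
    ([iter_psi_id]).  Bijectivity follows, the inverse of psi being psi^(n-1). *)

Set Implicit Arguments.
Unset Strict Implicit.
Unset Printing Implicit Defensive.

Implicit Types (n k x : nat) (w : nat -> bool) (rs cs : seq nat).

(** * Sorted sequences and intervals *)

Lemma iota1 n : 0 < n -> iota 1 n = 1 :: iota 2 n.-1.
Proof. by case: n. Qed.

Lemma sorted_head s y : sorted ltn s -> y \in s -> head 0 s <= y.
Proof.
case: s => //= z s /(order_path_min ltn_trans)/allP sub.
by rewrite inE => /predU1P[-> //|/sub/ltnW].
Qed.

Lemma index_sorted s a b : sorted ltn s -> a \in s -> b \in s ->
  (index a s < index b s) = (a < b).
Proof.
move=> ss a_in b_in; apply/idP/idP; first exact: (sorted_ltn_index ltn_trans ss).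
apply: contraTT; rewrite -!leqNgt leq_eqVlt => /predU1P[E|].
  by rewrite -(nth_index 0 b_in) E nth_index.
by move/(sorted_ltn_index ltn_trans ss _ _ b_in a_in)/ltnW.
Qed.

Lemma head_filter w s : has w s -> head 0 (filter w s) = nth 0 s (find w s).
Proof. by elim: s => //= a s IH; case: ifP. Qed.

(** * Tableaux of near-hook shape *)

(** The corner is kept as a parameter because shape considerations alone,
    which come before standardness, do not force it to be 1.  The data rs and
    cs are the rest of the first row and of the first column, so that
    transposition just exchanges them. *)
Definition near_hook_tab a rs cs x : tableau :=
  (a :: rs) :: [:: head 0 cs; x] :: [seq [:: y] | y <- behead cs].

Lemma column0_near_hook_tab a rs cs x : 0 < size cs ->
  column (near_hook_tab a rs cs x) 0 = a :: cs.
Proof.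
case: cs => // h s _; rewrite /column /=; congr [:: _, _ & _].
by elim: s => //= y s ->.
Qed.

Lemma transpose_near_hook_tab a rs cs x : 0 < size rs -> 0 < size cs ->
  transpose (near_hook_tab a rs cs x) = near_hook_tab a cs rs x.
Proof.
move=> rs_gt0 cs_gt0; rewrite /transpose.
have colS j : j.+1 < size rs -> column (near_hook_tab a rs cs x) j.+2 = [:: nth 0 rs j.+1].
  rewrite /column /= ltnS => -> /=; congr (_ :: _).
  by elim: (behead cs).
have col1 : column (near_hook_tab a rs cs x) 1 = [:: head 0 rs; x].
  rewrite /column /= ltnS rs_gt0 /= nth0; congr [:: _, _ & _].
  by elim: (behead cs).
case: rs rs_gt0 colS col1 => // r0 r _ colS col1.
rewrite {1}/near_hook_tab /= /mkseq /= column0_near_hook_tab // col1; congr [:: _, _ & _].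
rewrite -[r in RHS](mkseq_nth 0) /mkseq -[2]/(2 + 0) iotaDl -!map_comp.
by apply/eq_in_map => j; rewrite mem_iota /= => j_lt; rewrite colS.
Qed.

Lemma shape_near_hook_tab a rs cs x :
  shape (near_hook_tab a rs cs x) = (size rs).+1 :: 2 :: nseq (size cs).-1 1.
Proof.
rewrite /shape /=; congr [:: _, _ & _]; rewrite -size_behead.
by elim: (behead cs) => //= y s ->.
Qed.

Lemma perm_flatten_near_hook_tab a rs cs x : 0 < size cs ->
  perm_eq (flatten (near_hook_tab a rs cs x)) (a :: rs ++ x :: cs).
Proof.
case: cs => // h s _; rewrite /= perm_cons perm_cat2l.
have -> : flatten [seq [:: y] | y <- s] = s by elim: s => //= y s ->.
by rewrite (perm_catCA [:: h] [:: x] s).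
Qed.

Lemma sumn_near_hook n k : 2 <= k <= n - 2 -> sumn (near_hook n k) = n.
Proof. by move=> kn; rewrite /near_hook /= sumn_nseq; lia. Qed.

(** Only two inequalities besides sortedness of the arms matter: those at the
    two neighbours of the cell (2,2). *)
Lemma near_hook_tab_syt n k rs cs x : 2 <= k <= n - 2 ->
  size cs = k.-1 -> perm_eq (rs ++ x :: cs) (iota 2 n.-1) ->
  sorted ltn rs -> sorted ltn cs -> head 0 rs < x -> head 0 cs < x ->
  is_syt (near_hook n k) (near_hook_tab 1 rs cs x).
Proof.
move=> kn szc prc sr sc rx cx.
have szr : size rs = (n - k).-1.
  by have := perm_size prc; rewrite size_cat /= szc size_iota; lia.
have gt1 y : y \in rs ++ x :: cs -> 1 < y.
  by rewrite (perm_mem prc) mem_iota => /andP[].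
have s1 s : sorted ltn s -> {subset s <= rs ++ x :: cs} -> sorted ltn (1 :: s).
  case: s => //= y s -> sub; rewrite andbT; apply: gt1; apply: sub.
  exact: mem_head.
have s1r : sorted ltn (1 :: rs) by apply: s1 => // y; rewrite mem_cat => ->.
have s1c : sorted ltn (1 :: cs).
  by apply: s1 => // y yc; rewrite mem_cat inE yc !orbT.
have single s : all (sorted ltn) [seq [:: y] | y <- s].
  by apply/allP => _ /mapP[y _ ->].
apply/and4P; split.
- rewrite shape_near_hook_tab szr szc /near_hook; apply/eqP; congr [:: _, _ & nseq _ _]; lia.
- rewrite sumn_near_hook // (perm_trans (perm_flatten_near_hook_tab _ _ _ _)) ?szc //; first lia.
  by rewrite iota1 ?perm_cons //; lia.
- by move: s1r => /= ->; rewrite cx single.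
- rewrite transpose_near_hook_tab ?szr ?szc //; try lia.
  by move: s1c => /= ->; rewrite rx single.
Qed.

(** The converse of [near_hook_tab_syt]: the corner is smaller than every other
    entry, hence it is 1. *)
Lemma syt_near_hook_tabP n k T : 2 <= k <= n - 2 -> is_syt (near_hook n k) T ->
  exists rs cs x, [/\ T = near_hook_tab 1 rs cs x, size cs = k.-1,
    perm_eq (rs ++ x :: cs) (iota 2 n.-1), sorted ltn rs /\ sorted ltn cs
    & head 0 rs < x /\ head 0 cs < x].
Proof.
move=> kn /and4P[/eqP shT]; rewrite sumn_near_hook // => pT sT stT.
have [a [rs [cs [x [TE szr szc]]]]] : exists a rs cs x,
    [/\ T = near_hook_tab a rs cs x, size rs = (n - k).-1 & size cs = k.-1].
  case: T shT {pT sT stT} => [|r [|r2 rest]] //= [szr szr2 szrest].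
  case: r szr => [|a rs] szr; first by move: szr => /=; lia.
  case: r2 szr2 => [|h [|x []]] //= _.
  exists a, rs, (h :: map (head 0) rest), x; split; first 1 last.
  - by rewrite -szr.
  - by have := congr1 size szrest; rewrite /= !size_map size_nseq; lia.
  congr [:: _, _ & _]; rewrite /= -map_comp -[LHS]map_id; apply/eq_in_map => r.
  move/(map_f size); rewrite -/(shape rest) szrest => /nseqP[].
  by case: r => [|y []].
have rs_gt0 : 0 < size rs by lia.
have cs_gt0 : 0 < size cs by lia.
move: sT stT pT; rewrite {}TE transpose_near_hook_tab //= => /and3P[sr /andP[cx _] _].
case/and3P => sc /andP[rx _] _ pT.
have {}pT : perm_eq (a :: rs ++ x :: cs) (iota 1 n).
  by apply: perm_trans pT; rewrite perm_sym; exact: perm_flatten_near_hook_tab.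
have a1 : a = 1.
  have : 1 \in a :: rs ++ x :: cs by rewrite (perm_mem pT) mem_iota; lia.
  have : a \in iota 1 n by rewrite -(perm_mem pT) mem_head.
  rewrite mem_iota inE mem_cat inE => /andP[a_gt0 _].
  have path1 s : path ltn a s -> 1 \in s -> a < 1.
    by move=> /(order_path_min ltn_trans)/allP sub /sub.
  have ax : a < x.
    by move: cs_gt0 sc cx {pT}; case: (cs) => //= h s _ /andP[ah _]; exact: ltn_trans.
  case/or4P => [/eqP //|/(path1 _ sr)|/eqP x1|/(path1 _ sc)]; lia.
exists rs, cs, x; rewrite a1; split=> //.
- have : perm_eq (1 :: rs ++ x :: cs) (1 :: iota 2 n.-1).
    by rewrite -iota1; [move: pT; rewrite a1 | lia].
  by rewrite perm_cons.
- by rewrite (path_sorted sr) (path_sorted sc).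
Qed.

(** * Tableaux from marked binary words *)

Definition letters n w x := [seq i <- iota 2 n.-1 | w i && (i != x)].
Definition word_tab n w x :=
  near_hook_tab 1 (letters n (predC w) x) (letters n w x) x.

(** The mark x is a place where w leaves its initial value w 1.  The witness y
    says that w has left this value before, i.e. that x is not the first such
    place; this is what makes the entry x exceed both of its neighbours in the
    cell (2,2). *)
Definition marked_word n w x :=
  [/\ x <= n, w x.-1 = w 1, w x = ~~ w 1 & exists2 y, 1 < y < x & w y = ~~ w 1].

Lemma letters_sorted n w x : sorted ltn (letters n w x).
Proof. exact/(sorted_filter ltn_trans)/iota_ltn_sorted. Qed.

Lemma mem_letters n w x i :
  (i \in letters n w x) = [&& 2 <= i <= n, w i & i != x].
Proof. rewrite mem_filter mem_iota andbC; case: (_ && (i != x)); lia. Qed.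

Lemma marked_word_neg n w x : marked_word n w x -> marked_word n (predC w) x.
Proof.
by case=> xn wb wx [y yx wy]; split=> //=; rewrite ?wb ?wx //; exists y; rewrite ?wy.
Qed.

Lemma marked_word_gt3 n w x : marked_word n w x -> 3 < x.
Proof.
case=> _ wb _ [y /andP[y1 yx] wy].
have : y != x.-1 by apply/eqP => E; move: wy; rewrite E wb; case: (w 1).
lia.
Qed.

(** Below the mark both values occur at positions above 1: w 1 at x - 1, its
    negation at the earlier position y.  So whichever value selects the
    letters of a row or column, one of them is smaller than x. *)
Lemma head_letters_lt n w x : marked_word n w x ->
  0 < size (letters n w x) /\ head 0 (letters n w x) < x.
Proof.
move=> mk; have x3 := marked_word_gt3 mk; case: mk => xn wb _ [y yx wy].
have [z zx wz] : exists2 z, 1 < z < x & w z.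
  case w1: (w 1); first by exists x.-1; rewrite ?wb //; lia.
  by exists y => //; rewrite wy w1.
have zs : z \in letters n w x by rewrite mem_letters wz; lia.
split; first by case: (letters _ _ _) zs.
by apply: leq_ltn_trans (sorted_head (letters_sorted _ _ _) zs) _; lia.
Qed.

Lemma transpose_word_tab n w x : marked_word n w x ->
  transpose (word_tab n w x) = word_tab n (predC w) x.
Proof.
move=> mk; have [s1 _] := head_letters_lt mk.
have [s2 _] := head_letters_lt (marked_word_neg mk).
rewrite /word_tab transpose_near_hook_tab //; congr (near_hook_tab 1 _ _ x).
by apply: eq_filter => i; rewrite /= negbK.
Qed.

Lemma eq_word_tab n w w' x : {in iota 1 n, w =1 w'} ->
  word_tab n w x = word_tab n w' x.
Proof.
move=> eqw; have eqs v v' : {in iota 1 n, v =1 v'} -> letters n v x = letters n v' x.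
  move=> ev; apply: eq_in_filter => i i_in; rewrite ev // mem_iota.
  by move: i_in; rewrite mem_iota; lia.
by rewrite /word_tab (eqs w w') // (eqs (predC w) (predC w')) // => i /eqw /= ->.
Qed.

(** The mark is left out of the letters, and exactly one of the positions 1 and
    x carries the value true. *)
Lemma size_letters n w x : marked_word n w x ->
  (size (letters n w x)).+1 = count w (iota 1 n).
Proof.
move=> mk; have x3 := marked_word_gt3 mk; case: mk => xn wb wx _.
rewrite iota1; last lia.
have -> : letters n w x = filter (predC1 x) (filter w (iota 2 n.-1)).
  by rewrite -filter_predI; apply: eq_filter => i /=; rewrite andbC.
rewrite size_filter /= -[count w (iota 2 _)]size_filter.
rewrite -(count_predC (pred1 x) (filter _ _)) count_uniq_mem ?filter_uniq ?iota_uniq //.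
rewrite mem_filter mem_iota wx -[X in _ = _ + (_ + X)]/(count (predC1 x) _).
by case: (w 1) => /=; lia.
Qed.

Lemma word_tab_syt n k w x : 2 <= k <= n - 2 -> marked_word n w x ->
  count w (iota 1 n) = k -> is_syt (near_hook n k) (word_tab n w x).
Proof.
move=> kn mk cw; apply: near_hook_tab_syt => //; try exact: letters_sorted.
- by rewrite -cw -(size_letters mk).
- have x3 := marked_word_gt3 mk; case: mk => xn _ _ _.
  apply: uniq_perm; rewrite ?iota_uniq //.
    rewrite cat_uniq [uniq (x :: _)]cons_uniq ![uniq (letters _ _ _)]filter_uniq ?iota_uniq //=.
    rewrite !mem_letters eqxx !andbF /= andbT; apply/hasPn => i.
    by rewrite !mem_letters => /and3P[_ wi _] /=; rewrite wi andbF.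
  move=> i; rewrite mem_cat inE !mem_letters mem_iota /=.
  by case: eqP => [->|_]; case: (w i); rewrite ?andbT ?andbF ?orbF /=; lia.
- exact: (head_letters_lt (marked_word_neg mk)).2.
- exact: (head_letters_lt mk).2.
Qed.

Lemma letters_unique n w x s : sorted ltn s ->
  (forall i, (i \in s) = [&& 2 <= i <= n, w i & i != x]) -> s = letters n w x.
Proof.
move=> ss mems; apply: (irr_sorted_eq ltn_trans ltnn ss (letters_sorted _ _ _)).
by move=> i; rewrite mem_letters mems.
Qed.

(** The letters other than 1 and x are dictated by the first column.  The values
    at 1 and x are then forced by the requirements w (x-1) = w 1 and
    w x <> w 1. *)
Lemma syt_word_tabP n k T : 2 <= k <= n - 2 -> is_syt (near_hook n k) T ->
  exists w x, [/\ T = word_tab n w x, marked_word n w x & count w (iota 1 n) = k].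
Proof.
move=> kn /(syt_near_hook_tabP kn)[rs [cs [x [-> szc prc [sr sc] [rx cx]]]]].
have memE i : (i \in rs ++ x :: cs) = (1 < i <= n).
  by rewrite (perm_mem prc) mem_iota; lia.
have : uniq (rs ++ x :: cs) by rewrite (perm_uniq prc) iota_uniq.
rewrite cat_uniq /= negb_or => /and4P[ur /andP[xr dis] xc uc].
have disj i : i \in cs -> i \notin rs by move/(hasPn dis).
have szr : size rs = (n - k).-1.
  by have := perm_size prc; rewrite size_cat /= szc size_iota; clear -kn; lia.
have h_in s : 0 < size s -> head 0 s \in s by case: s => //= *; exact: mem_head.
have hc : head 0 cs \in cs by apply: h_in; rewrite szc; clear -kn; lia.
have hr : head 0 rs \in rs by apply: h_in; rewrite szr; clear -kn; lia.
have in_rs i : i \in rs -> 1 < i <= n by rewrite -memE mem_cat => ->.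
have in_cs i : i \in cs -> 1 < i <= n by rewrite -memE mem_cat inE => ->; rewrite !orbT.
have xn : 1 < x <= n by rewrite -memE mem_cat mem_head orbT.
have /andP[hr1 _] := in_rs _ hr; have /andP[hc1 _] := in_cs _ hc.
have /andP[_ x_n] := xn.
have [x1 b1 bx] : [/\ (x == 1) = false, 1 < x.-1 & x.-1 != x] by clear -rx hr1; split; lia.
pose w i := if i == 1 then x.-1 \in cs else if i == x then x.-1 \notin cs else i \in cs.
have wE i : 1 < i -> i != x -> w i = (i \in cs).
  by rewrite /w => i1 /negbTE ->; case: eqP => // E; rewrite E in i1.
have w1 : w 1 = (x.-1 \in cs) by rewrite /w eqxx.
have wx : w x = (x.-1 \notin cs) by rewrite /w eqxx x1.
have mk : marked_word n w x.
  split; rewrite ?w1 ?wx //; first by rewrite wE.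
  have [b_in|b_out] := boolP (x.-1 \in cs).
    exists (head 0 rs); first by rewrite hr1.
    rewrite wE ?ltn_eqF //; apply/negbTE/negP => /disj; by rewrite hr.
  by exists (head 0 cs); rewrite ?hc1 // wE ?ltn_eqF.
have csE : cs = letters n w x.
  apply: letters_unique => // i; have [->|ix] := eqVneq i x.
    by rewrite (negbTE xc) !andbF.
  rewrite andbT; apply/idP/andP => [ic|[/andP[i1 _]]]; last by rewrite wE.
  by have ib := in_cs _ ic; case/andP: (ib) => i1 _; rewrite ib wE.
have rsE : rs = letters n (predC w) x.
  apply: letters_unique => // i; have [->|ix] := eqVneq i x.
    by rewrite (negbTE xr) !andbF.
  rewrite andbT /=; apply/idP/andP => [ir|[ib]].
    have ib := in_rs _ ir; case/andP: (ib) => i1 _; rewrite ib wE //.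
    by split=> //; apply: contraL ir => /disj.
  case/andP: (ib) => i1 _; rewrite wE // => /negbTE ic.
  by move: ib; rewrite -memE mem_cat inE (negbTE ix) ic !orbF.
exists w, x; split=> //; first by rewrite /word_tab -csE -rsE.
by rewrite -(size_letters mk) -csE szc prednK //; case/andP: kn => /ltnW.
Qed.

(** * Cyclic descents *)

Definition csucc n i := if i == n then 1 else i.+1.
Definition rot_word n w i := w (csucc n i).

Lemma row_of_near_hook_tab rs cs x y : 0 < size cs ->
  row_of (near_hook_tab 1 rs cs x) y =
    if y \in 1 :: rs then 0 else if y == x then 1 else (index y cs).+1.
Proof.
case: cs => // h s _; rewrite /row_of /=; case: (y \in 1 :: rs) => //.
rewrite !inE eq_sym; case: (h == y) => /=; first by case: ifP.
case: (y == x) => //; congr _.+2; rewrite /index.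
by elim: s => //= z s IH; rewrite inE eq_sym IH.
Qed.

(** The cyclic descent set is the word itself, rotated by one.  For i + 1 in the
    first row or column this is clear, as such a letter is reached by a descent
    exactly in the column.  For i + 1 = x the step is a descent when x - 1
    is in the first row, and w x is the negation of w (x-1); the rule for n
    asks whether x - 1 is in the first column, which is w (x-1) = w 1. *)
Lemma mem_cDes n w x i : marked_word n w x ->
  (i \in cDes n (word_tab n w x)) = (1 <= i <= n) && rot_word n w i.
Proof.
move=> mk; have x3 := marked_word_gt3 mk.
have [sc hx] := head_letters_lt mk; case: (mk) => xn wb wx _.
have memC j : 1 < j <= n -> j != x -> (j \in 1 :: letters n (predC w) x) = ~~ w j.
  by move=> jn jx; rewrite inE mem_letters /= jx; lia.
rewrite mem_cat mem_filter mem_iota /rot_word /csucc.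
have -> : (i \in (if (entry22 (word_tab n w x)).-1 \in column (word_tab n w x) 0
             then [:: n] else [::])) = (i == n) && w 1.
  rewrite /word_tab column0_near_hook_tab // /entry22 /= inE mem_letters wb.
  have -> : x.-1 == 1 = false by lia.
  have -> : (1 < x.-1 <= n) && (w 1 && (x.-1 != x)) = w 1 by lia.
  by case: (w 1); rewrite ?inE ?andbT ?andbF.
case: eqP => [->|ni].
  have -> : 0 < n < 1 + n.-1 = false by lia.
  by rewrite andbF; have -> : 0 < n <= n by lia.
rewrite andFb orbF andbC; have -> : (0 < i < 1 + n.-1) = (0 < i <= n) by lia.
apply: andb_id2l => i_in; rewrite !row_of_near_hook_tab //.
have xnot : x \in 1 :: letters n (predC w) x = false.
  by rewrite inE mem_letters eqxx !andbF; lia.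
have [ix|ix] := eqVneq i.+1 x.
  rewrite ix xnot wx.
  have -> : i = x.-1 by lia.
  rewrite memC ?wb; try lia.
  case: (w 1) => //=; case: ifP => //; lia.
rewrite (memC i.+1) //; last lia.
case wi: (w i.+1) => //=.
case: ifP => // iC.
have i_in_s : i.+1 \in letters n w x by rewrite mem_letters wi ix; lia.
have [ix'|ix'] := eqVneq i x.
  rewrite ltnS; move: hx sc i_in_s; case: (letters n w x) => //= h s.
  by case: eqP; rewrite -?ix' //; lia.
have i1 : i != 1 by apply: contraFneq iC => ->; rewrite mem_head.
have : (i \in 1 :: letters n (predC w) x) = ~~ w i by apply: memC => //; lia.
rewrite iC => /esym/negbFE w_i.
by rewrite ltnS (index_sorted (letters_sorted _ _ _)) ?ltnSn // mem_letters w_i ix'; lia.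
Qed.

Lemma mem_shift_down n D i : 1 < n -> {subset D <= iota 1 n} ->
  (i \in shift_down n D) = (1 <= i <= n) && (csucc n i \in D).
Proof.
move=> n1 Dn; apply/mapP/andP => [[j jD ->]|[i_in nD]].
  have := Dn _ jD; rewrite mem_iota /csucc => j_in.
  case: (eqVneq j 1) jD j_in => [->|j1] jD j_in; first by rewrite eqxx; split=> //; lia.
  by split; first lia; case: eqP => [|_]; [lia | rewrite prednK //; lia].
exists (csucc n i) => //; rewrite /csucc; case: (eqVneq i n) => //= _; case: eqP; lia.
Qed.

(** * The action of psi on marked words *)

(** The new position of the mark.  In the second branch x has become a place
    where the rotated word enters its initial value, so the mark goes to the
    next return of w to w 1 after x.  If there is none up to n, the
    search gives n + 1, cyclically the position 1 itself; rotation then turns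
    this into n. *)
Definition slide n w x :=
  if w 2 == w 1 then x.-1
  else x + find (fun p => w p == w 1) (iota x.+1 (n - x)).

Lemma slideP n w x : marked_word n w x -> w 2 != w 1 ->
  [/\ x <= slide n w x <= n,
     forall i, x <= i <= slide n w x -> w i = ~~ w 1
   & slide n w x < n -> w (slide n w x).+1 = w 1].
Proof.
move=> mk w2; have x3 := marked_word_gt3 mk; case: mk => xn wb wx _.
rewrite /slide (negbTE w2); set p := (fun i => _); set f := find _ _.
have fn : f <= n - x by rewrite -[n - x](size_iota x.+1) find_size.
split; first lia.
- move=> i; case: (eqVneq i x) => [-> //|ix] i_in.
  have : i - x.+1 < f by lia.
  move/(before_find 0); rewrite nth_iota /p; last lia.
  have -> : x.+1 + (i - x.+1) = i by lia.
  by case: (w i) (w 1) => [] [].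
- move=> fl; have : has p (iota x.+1 (n - x)) by rewrite has_find size_iota -/f; lia.
  by move/(nth_find 0); rewrite -/f nth_iota /p ?addSn => [/eqP //|]; lia.
Qed.

(** When w 2 = w 1 the witness y of an earlier departure just moves along.  When
    w 2 <> w 1 the value to be left is now w 2, and position x - 1, where w
    takes the value w 1, witnesses an earlier departure from it. *)
Lemma marked_word_rot n w x : marked_word n w x ->
  marked_word n (rot_word n w) (slide n w x).
Proof.
move=> mk; have x3 := marked_word_gt3 mk.
have rotE i : i < n -> rot_word n w i = w i.+1.
  by rewrite /rot_word /csucc; case: eqP => // ->; rewrite ltnn.
have rotn : rot_word n w n = w 1 by rewrite /rot_word /csucc eqxx.
have [w2|w2] := eqVneq (w 2) (w 1).
  rewrite /slide w2 eqxx; case: mk => xn wb wx [y yx wy].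
  have y2 : y != 2 by apply: contraTneq isT => y2; move: wy; rewrite y2 w2; case: (w 1).
  split; rewrite ?rotE ?w2; try lia.
  - by have -> : x.-1.-1.+1 = x.-1 by lia.
  - by have -> : x.-1.+1 = x by lia.
  have : y != x.-1 by apply: contraTneq isT => yb; move: wy; rewrite yb wb; case: (w 1).
  exists y.-1; first lia.
  by rewrite rotE ?prednK //; lia.
have [sx below after] := slideP mk w2.
have {}w2 : w 2 = ~~ w 1 by case: (w 2) (w 1) w2 => [] [].
case: mk => xn wb wx _; split; rewrite ?[rot_word n w 1]rotE ?w2 ?negbK; try lia.
- by rewrite rotE; [apply: below|]; lia.
- case: (ltnP (slide n w x) n) => sn; first by rewrite rotE // after.
  by have -> : slide n w x = n by lia.
- have x12 : x.-1 != 2 by apply: contraTneq isT => xb; move: w2; rewrite -xb wb; case: (w 1).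
  exists x.-2; first lia.
  by rewrite rotE -?wb; [congr w|]; lia.
Qed.

Lemma count_rot_word n w : count (rot_word n w) (iota 1 n) = count w (iota 1 n).
Proof.
case: n => // n; rewrite -[in LHS]addn1 iotaD count_cat /= /rot_word /csucc.
rewrite !addn1 add1n eqxx addn0 addnC; congr (_ + _).
rewrite -[2]/(1 + 1) [in RHS]iotaDl count_map; apply: eq_in_count => i.
by rewrite mem_iota /=; case: eqP => //; lia.
Qed.

(** Departures from w 1 and returns to it alternate, so counting all changes
    before a mark amounts to counting the departures, but this number does not
    refer to the initial value and is easier to follow under rotation. *)
Definition changes w x := count (fun i => w i != w i.-1) (iota 2 (x - 2)).

(** The change lost at position 2, when there is one, is made up for by the
    change at the old mark, since w is constant from there to the new one. *)
Lemma changes_rot n w x : marked_word n w x ->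
  changes (rot_word n w) (slide n w x) = changes w x.
Proof.
move=> mk; have x3 := marked_word_gt3 mk; have mk' := marked_word_rot mk.
have x3' := marked_word_gt3 mk'; case: (mk') => xn' _ _ _; case: (mk) => xn wb wx _.
have -> : changes (rot_word n w) (slide n w x)
    = count (fun i => w i != w i.-1) (iota 3 (slide n w x - 2)).
  rewrite -[3]/(1 + 2) iotaDl count_map; apply: eq_in_count => i.
  rewrite mem_iota /rot_word /csucc /= => i_in.
  have -> : i == n = false by lia.
  have -> : i.-1 == n = false by lia.
  by rewrite prednK //; lia.
rewrite /changes; have -> : x - 2 = (x - 3).+1 by lia.
rewrite /=; have [w2|w2] := eqVneq (w 2) (w 1).
  rewrite /slide w2 eqxx add0n; congr (count _ (iota _ _)); lia.
have [sx below _] := slideP mk w2.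
have -> : slide n w x - 2 = (x - 3) + (slide n w x - x).+1 by lia.
rewrite iotaD count_cat addnC; congr (_ + _).
have -> : 3 + (x - 3) = x by lia.
have no_change i : i \in iota x.+1 (slide n w x - x) -> w i = w i.-1.
  by rewrite mem_iota => i_in; rewrite (below i) ?(below i.-1) //; lia.
have -> : count (fun i => w i != w i.-1) (iota x (slide n w x - x).+1) = 1.
  rewrite /= wx wb (_ : count _ _ = 0); first by case: (w 1).
  apply/eqP; rewrite -leqn0 leqNgt -has_count.
  by apply/hasPn => i /no_change ->; rewrite eqxx.
by move: w2; case: (w 2); case: (w 1).
Qed.

(** A mark is itself a change, so it is counted at every later mark. *)
Lemma changes_inj n w x x' : marked_word n w x -> marked_word n w x' ->
  changes w x = changes w x' -> x = x'.
Proof.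
wlog xx' : x x' / x < x' => [wl mk mk' E|mk mk'].
  by case: (ltngtP x x') => // lt; [|apply/esym]; apply: wl lt _ _ _.
have x3 := marked_word_gt3 mk; case: mk => _ wb wx _; rewrite /changes.
have -> : x' - 2 = (x - 2) + (x' - x.+1).+1 by lia.
rewrite iotaD count_cat (_ : 2 + (x - 2) = x) /= ?wx ?wb; last lia.
by case: (w 1) => /=; lia.
Qed.

(** * The map psi *)

Lemma slide_neg n w x : slide n (predC w) x = slide n w x.
Proof.
rewrite /slide /= (inj_eq negb_inj); case: ifP => // _; congr (_ + _).
by apply: eq_find => i /=; rewrite (inj_eq negb_inj).
Qed.

(** Here w 2 is false, i.e. 1 is no cyclic descent.  The three cases for the
    entry (2,2) are the two branches of [slide]: if w 1 is false, x - 1 is in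
    the first row; otherwise the column entry below x - 1 is the next position
    after x where w is true, and x - 1 is at the bottom when there is none. *)
Lemma psi_no1_word_tab n w x : marked_word n w x -> w 2 = false ->
  psi_no1 n (word_tab n w x) = word_tab n (rot_word n w) (slide n w x).
Proof.
move=> mk w2; have mk' := marked_word_rot mk; have x3 := marked_word_gt3 mk.
have [sc _] := head_letters_lt mk.
have rot1 : rot_word n w 1 = false.
  by rewrite /rot_word /csucc; case: eqP => // n1; case: mk; lia.
have [n0 wx'] : 0 < n /\ rot_word n w (slide n w x).
  by case: mk' => ? _; rewrite rot1 => -> _; case: mk; lia.
have psi22E : psi22 n (word_tab n w x) = slide n w x.
  have [xn wb wx _] := mk.
  rewrite /psi22 /word_tab column0_near_hook_tab //; set cs := letters n w x.
  rewrite -[entry22 _]/x -[head [::] _]/(1 :: letters n (predC w) x).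
  have -> : (x.-1 \in 1 :: letters n (predC w) x) = ~~ w 1.
    by rewrite inE mem_letters /= wb; lia.
  rewrite /slide w2; case w1: (w 1) => //=; rewrite w1 in wb wx.
  (* The position x - 1 cuts the column; x itself belongs to neither part. *)
  have csE : cs = letters x.-2 w x ++ x.-1 :: filter w (iota x.+1 (n - x)).
    rewrite /cs /letters; have -> : n.-1 = x.-2.-1 + (n - x).+2 by lia.
    rewrite iotaD filter_cat; congr (_ ++ _).
    have -> : 2 + x.-2.-1 = x.-1 by lia.
    rewrite /= wb (_ : x.-1 != x) /=; last lia.
    rewrite prednK ?eqxx ?andbF /=; last lia.
    congr (_ :: _); apply: eq_in_filter => i; rewrite mem_iota => i_in.
    by rewrite (_ : i != x) ?andbT //; lia.
  have bA : x.-1 \notin letters x.-2 w x by rewrite mem_letters; lia.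
  have findE : find (fun p => w p == true) (iota x.+1 (n - x))
      = find w (iota x.+1 (n - x)) by apply: eq_find => p; rewrite eqb_id.
  have x1 : (1 == x.-1) = false by lia.
  have bcs : x.-1 \in cs by rewrite csE mem_cat mem_head orbT.
  rewrite findE csE last_cat x1 index_cat (negbTE bA) /= eqxx addn0.
  have [/hasP[p p_in wp]|no_more] := boolP (has w (iota x.+1 (n - x))).
    have := p_in; rewrite mem_iota => p_bd.
    case: ifP => [/eqP xl|_].
      have : last x.-1 (filter w (iota x.+1 (n - x))) \in filter w (iota x.+1 (n - x)).
        have : p \in filter w (iota x.+1 (n - x)) by rewrite mem_filter wp.
        by case: (filter _ _) => //= a s _; exact: mem_last.
      by rewrite -xl mem_filter mem_iota ltnNge leq_pred andbF.
    rewrite nth_cat ltnNge leqnSn /= subSn // subnn /= nth0.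
    have hs : has w (iota x.+1 (n - x)) by apply/hasP; exists p.
    rewrite head_filter // nth_iota; first by rewrite addSn.
    by move: hs; rewrite has_find size_iota.
  rewrite hasNfind // size_iota.
  move: no_more; rewrite has_filter negbK => /eqP -> /=; rewrite eqxx; lia.
have rowE : [seq i <- iota 1 n | i \notin cDes n (word_tab n w x)]
    = 1 :: letters n (predC (rot_word n w)) (slide n w x).
  rewrite iota1 //= mem_cDes // rot1 andbF /=; congr (_ :: _).
  apply: eq_in_filter => i; rewrite mem_iota => i_in /=; rewrite mem_cDes //.
  have -> : 0 < i <= n by lia.
  by case: eqP => [->|_]; rewrite ?wx' ?andbT.
rewrite /psi_no1 rowE psi22E.
suff -> : [seq i <- iota 1 n
   | (i \notin 1 :: letters n (predC (rot_word n w)) (slide n w x)) & (i != slide n w x)]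
   = letters n (rot_word n w) (slide n w x) by [].
rewrite iota1 //=; apply: eq_in_filter => i; rewrite mem_iota => i_in.
rewrite inE mem_letters /=; case: (i != _); rewrite ?andbF ?andbT //.
by case: (rot_word n w i); rewrite ?andbF ?andbT; lia.
Qed.

(** The case where 1 is a cyclic descent reduces to the other one, because
    [slide] and the rotation both commute with negation. *)
Lemma psi_word_tab n w x : marked_word n w x ->
  psi n (word_tab n w x) = word_tab n (rot_word n w) (slide n w x).
Proof.
move=> mk; have x3 := marked_word_gt3 mk; have mkC := marked_word_neg mk.
have r1 : rot_word n w 1 = w 2.
  by rewrite /rot_word /csucc; case: eqP => // n1; case: mk; lia.
rewrite /psi mem_cDes // r1; case w2: (w 2); last by rewrite andbF psi_no1_word_tab.
have -> : 0 < 1 <= n by case: mk; lia.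
rewrite transpose_word_tab // psi_no1_word_tab //=; last by rewrite w2.
rewrite transpose_word_tab; last exact: marked_word_rot.
by rewrite slide_neg; apply: eq_word_tab => i _ /=; rewrite /rot_word /= negbK.
Qed.

Lemma psi_is_syt n k T : 2 <= k <= n - 2 ->
  is_syt (near_hook n k) T -> is_syt (near_hook n k) (psi n T).
Proof.
move=> kn /(syt_word_tabP kn)[w [x [-> mk cw]]]; rewrite psi_word_tab //.
by apply: word_tab_syt => //; [exact: marked_word_rot | rewrite count_rot_word].
Qed.

Lemma iter_rot_word n m w i : 0 < i <= n ->
  iter m (rot_word n) w i = w ((i.-1 + m) %% n).+1.
Proof.
elim: m i => [|m IH] i i_in; first by rewrite addn0 modn_small ?prednK //; lia.
rewrite iterS {1}/rot_word IH; last by rewrite /csucc; case: eqP; lia.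
rewrite /csucc; case: eqP => [iE|_]; last by congr (w (_ %% _).+1); lia.
by rewrite add0n -modnDl iE; congr (w (_ %% _).+1); lia.
Qed.

Lemma iter_psi n w x m : marked_word n w x -> exists2 x',
  iter m (psi n) (word_tab n w x) = word_tab n (iter m (rot_word n) w) x'
  & marked_word n (iter m (rot_word n) w) x'
    /\ changes (iter m (rot_word n) w) x' = changes w x.
Proof.
move=> mk; elim: m => [|m [x' E [mk' ch]]]; first by exists x.
exists (slide n (iter m (rot_word n) w) x'); first by rewrite /= E psi_word_tab.
by split; [exact: marked_word_rot | rewrite changes_rot].
Qed.

Lemma eq_marked_word n w w' x : {in iota 1 n, w =1 w'} ->
  marked_word n w x -> marked_word n w' x.
Proof.
move=> eqw mk; have x3 := marked_word_gt3 mk; case: mk => xn wb wx [y yx wy].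
by split=> //; rewrite -?eqw ?mem_iota //; try lia; exists y => //;
  rewrite -!eqw ?mem_iota //; lia.
Qed.

Lemma eq_changes n w w' x : {in iota 1 n, w =1 w'} -> x <= n ->
  changes w x = changes w' x.
Proof.
move=> eqw xn; apply: eq_in_count => i; rewrite mem_iota => i_in.
by rewrite !eqw ?mem_iota //; lia.
Qed.

(** The words after n rotations and at the start agree only on positions
    1, ..., n, hence the transport lemmas along such agreement. *)
Lemma iter_psi_id n k T : 2 <= k <= n - 2 ->
  is_syt (near_hook n k) T -> iter n (psi n) T = T.
Proof.
move=> kn /(syt_word_tabP kn)[w [x [-> mk _]]].
have [x' -> [mk' ch]] := iter_psi n mk.
have eqw : {in iota 1 n, iter n (rot_word n) w =1 w}.
  move=> i; rewrite mem_iota => i_in; rewrite iter_rot_word; last lia.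
  by rewrite modnDr modn_small ?prednK //; lia.
rewrite (eq_word_tab _ eqw); congr (word_tab n w _).
apply: (changes_inj (eq_marked_word eqw mk') mk); rewrite -ch.
by apply/esym/(eq_changes eqw); case: mk'.
Qed.

Lemma cDes_psi n k T : 2 <= k <= n - 2 -> is_syt (near_hook n k) T ->
  cDes n (psi n T) =i shift_down n (cDes n T).
Proof.
move=> kn /(syt_word_tabP kn)[w [x [-> mk _]]] i.
rewrite psi_word_tab // mem_cDes; last exact: marked_word_rot.
rewrite mem_shift_down; first last.
- by move=> j; rewrite mem_cDes // mem_iota => /andP[]; lia.
- by lia.
rewrite mem_cDes //; apply: andb_id2l => i_in.
rewrite [rot_word n (rot_word n w) i]/rot_word.
by case: (rot_word _ _ _); rewrite /csucc; case: eqP; lia.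
Qed.

Theorem proposition3p15 (n k : nat) (hk : 2 <= k <= n - 2) :
  exists Psi : SYT (near_hook n k) -> SYT (near_hook n k),
    [/\ forall T : SYT (near_hook n k), sval (Psi T) = psi n (sval T),
        bijective Psi,
        forall T : SYT (near_hook n k), iter n Psi T = T
      & forall T : SYT (near_hook n k),
          cDes n (sval (Psi T)) =i shift_down n (cDes n (sval T))].
Proof.
pose Psi (T : SYT (near_hook n k)) : SYT (near_hook n k) :=
  exist _ (psi n (sval T)) (psi_is_syt hk (svalP T)).
have iterE m T : sval (iter m Psi T) = iter m (psi n) (sval T).
  by elim: m => //= m ->.
have Psi_n T : iter n Psi T = T.
  by apply: val_inj; rewrite /= iterE (iter_psi_id hk (svalP T)).
have n_gt0 : 0 < n by lia.
exists Psi; split=> //; last by move=> T; exact: cDes_psi hk (svalP T).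
by exists (iter n.-1 Psi) => T; rewrite -?iterS -?iterSr prednK.
Qed.
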